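(* Let $(M,\tau,\ell,\mathfrak m)$ be a metric measure spacetime and $f,g:M\to\bar{\mathbb R}$ causal. (i) For all $\alpha,\beta\ge0$, $$|\mathrm d(\alpha f+\beta g)|\ge\alpha|\mathrm df|+\beta|\mathrm dg|\qquad\mathfrak m\text{-a.e. on }M,$$ and $|\mathrm d(\alpha f)|=\alpha|\mathrm df|$ holds $\mathfrak m$-a.e. on $\mathrm{Vis}(M)$ if $\alpha=0$, and $\mathfrak m$-a.e. on $M$ if $\alpha>0$. (ii) A concave positively $1$-homogeneous function $h_x:[0,\infty)^2\to[0,\infty]$ can be associated to each $x\in M$ so that every $(\alpha,\beta)\in[0,\infty)^2$ with $(\alpha,\beta)\ne(0,0)$ satisfies $|\mathrm d(\alpha f+\beta g)|(y)=h_y(\alpha,\beta)$ for $\mathfrak m$-a.e. $y\in M$.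
   Context: Conventions in $\bar{\mathbb R}=[-\infty,+\infty]$: $+\infty-(+\infty)=+\infty$, $-\infty-(-\infty)=+\infty$, $\pm\infty+z=\pm\infty$ for every $z\in\bar{\mathbb R}$, $0\cdot(\pm\infty)=0$. A time separation on a set $M$ is a map $\ell:M\times M\to\{-\infty\}\cup[0,+\infty]$ with $\ell(x,x)=0$ and $\min\{\ell(x,y)+\ell(y,z),\ell(y,z)+\ell(x,y)\}\le\ell(x,z)$; write $x\le y$ if $\ell(x,y)\ge0$. A metric measure spacetime $(M,\tau,\ell,\mathfrak m)$: $\tau$ is a Polish topology, $\ell$ a time separation with $\le$ a partial order and $\{\ell\ge0\}$ closed in $M^2$, $\mathfrak m$ a non-zero non-negative Radon measure. $\gamma:[0,1]\to M$ is causal if $s\le t$ implies $\gamma_s\le\gamma_t$. Its causal speed $|\dot\gamma_t|\in[0,+\infty]$ is the density of the absolutely continuous part (w.r.t. Lebesgue measure) of the largest Borel measure $\nu$ on $[0,1]$ with $\nu((a,b))\le\ell(\gamma_a,\gamma_b)$ for all $0\le a<b\le1$; for a.e. $t$ it equals $\lim_{h\downarrow0}\ell(\gamma_t,\gamma_{t+h})/h$. $\mathrm{LCC}([0,1];M)$ is the set of left-continuous causal curves with the topology of the distance $\mathsf D(\gamma,\eta)=\mathsf d(\gamma_0,\eta_0)+\int_0^1\mathsf d(\gamma_t,\eta_t)\,\mathrm dt$, $\mathsf d$ a bounded distance inducing $\tau$. $\mathsf e_t(\gamma):=\gamma_t$. A causal function is an $\mathfrak m$-measurable $f:M\to\bar{\mathbb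 R}$ such that $x\le y$ implies $f(x)\le f(y)$. A test plan is a Borel probability measure $\boldsymbol\pi$ on $\mathrm{LCC}([0,1];M)$ such that for some $C>0$, $(\mathsf e_t)_*\boldsymbol\pi\le C\mathfrak m$ for all $t\in[0,1]$. A Borel $G:M\to[0,+\infty]$ is a weak subslope of $f$ if $\int[f(\gamma_1)-f(\gamma_0)]\,\mathrm d\boldsymbol\pi\ge\iint_0^1G(\gamma_t)|\dot\gamma_t|\,\mathrm dt\,\mathrm d\boldsymbol\pi$ for every test plan $\boldsymbol\pi$; $|\mathrm df|$ denotes the $\mathfrak m$-a.e. largest weak subslope (it exists and is $\mathfrak m$-a.e. unique). For a test plan $\boldsymbol\pi$ let $\rho_{\boldsymbol\pi}$ be the $\mathfrak m$-density of the push-forward of the measure $|\dot\gamma_t|\,\mathrm d\boldsymbol\pi(\gamma)\,\mathrm dt$ on $\mathrm{LCC}([0,1];M)\times[0,1]$ under $(\gamma,t)\mapsto\gamma_t$. $\mathrm{Vis}(M)$ is the $\mathfrak m$-essential union of the sets $\{\rho_{\boldsymbol\pi}>0\}$ over all test plans $\boldsymbol\pi$ (the smallest Borel set, up to $\mathfrak m$-null sets, containing each of them up to $\mathfrak m$-null sets). *)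

(* Defs.v *)
From HB Require Import structures.
From mathcomp Require Import all_boot all_order all_algebra.
From mathcomp Require Import all_classical all_reals all_analysis.
From mathcomp Require Import measurable_realfun.
Import Order.TTheory GRing.Theory Num.Theory.
Import numFieldNormedType.Exports.

Set Implicit Arguments.
Unset Strict Implicit.
Unset Printing Implicit Defensive.

Local Open Scope classical_set_scope.
Local Open Scope ring_scope.
Local Open Scope ereal_scope.

(* Arithmetic in [-oo, +oo] with the left operand dominant,
   (+oo) + z = +oo and (-oo) + z = -oo for every z (so the addition is not
   commutative), and (-oo) - (-oo) = +oo.  The convention 0 * (+oo) = 0 is the
   one of the library. *)
Section extended_arithmetic.
Context {R : realType}.
Implicit Types x y : \bar R.

Definition addx x y : \bar R := if x is r%:E then r%:E + y else x.

Definition subx x y : \bar R :=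
  match x, y with
  | -oo, -oo => +oo
  | _, _ => addx x (- y)
  end.

End extended_arithmetic.

(* Agrees with the integral on nonnegative measurable functions; it gives a
   meaning to an integral whose integrand is not known to be measurable. *)
Definition upper_integral d (T : measurableType d) (R : realType)
    (mu : {measure set T -> \bar R}) (f : T -> \bar R) : \bar R :=
  ereal_inf [set \int[mu]_x u x | u in
    [set u : T -> \bar R |
      measurable_fun [set: T] u /\ (forall x, 0 <= u x /\ f x <= u x)]].

Lemma upper_integralE d (T : measurableType d) (R : realType)
    (mu : {measure set T -> \bar R}) (f : T -> \bar R) :
  measurable_fun [set: T] f -> (forall x, 0 <= f x) ->
  upper_integral mu f = \int[mu]_x f x.
Proof.
move=> mf f0; apply/eqP; rewrite eq_le; apply/andP; split.
  by apply: ereal_inf_lbound; exists f => //; split => // x; rewrite f0 lexx.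
apply: le_ereal_inf_tmp => _ [u [mu_ fu] <-].
by apply: ge0_le_integral => // x _; case: (fu x).
Qed.

Section distances.
Context {R : realType}.

Definition is_distance (T : Type) (d : T -> T -> R) : Prop :=
  [/\ forall x y, (0 <= d x y)%R,
      forall x y, d x y = 0%R <-> x = y,
      forall x y, d x y = d y x &
      forall x y z, (d x z <= d x y + d y z)%R].

Definition dist_open (T : Type) (d : T -> T -> R) : set (set T) :=
  [set U | forall x, U x ->
    exists2 e : R, (0 < e)%R & forall y, (d x y < e)%R -> U y].

Definition induces_topology (T : topologicalType) (d : T -> T -> R) : Prop :=
  is_distance d /\ forall U : set T, open U <-> dist_open d U.

Definition bounded_distance (T : topologicalType) (d : T -> T -> R) : Prop :=
  induces_topology d /\ exists C : R, forall x y, (d x y <= C)%R.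

Definition complete_distance (T : topologicalType) (d : T -> T -> R) : Prop :=
  forall u : nat -> T,
    (forall e : R, (0 < e)%R -> exists N : nat, forall i j : nat,
      (N <= i)%N -> (N <= j)%N -> (d (u i) (u j) < e)%R) ->
    exists x : T, u @ \oo --> x.

Definition polish (T : topologicalType) : Prop :=
  (exists2 D : set T, countable D & dense D) /\
  exists2 d : T -> T -> R, induces_topology d & complete_distance d.

End distances.
Arguments polish R T : clear implicits.

Definition borel (T : ptopologicalType) := g_sigma_algebraType (@open T).

Definition radon (R : realType) (T : ptopologicalType)
    (mu : {measure set (borel T) -> \bar R}) : Prop :=
  (forall x : T, exists U : set T, [/\ open U, U x & mu U < +oo]) /\
  (forall A : set (borel T), measurable A ->
    mu A = ereal_sup [set mu K | K in
      [set K : set T | compact K /\ K `<=` A]]).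

Definition time_separation (R : realType) (T : Type)
    (l : T -> T -> \bar R) : Prop :=
  [/\ forall x y, l x y = -oo \/ 0 <= l x y,
      forall x, l x x = 0 &
      forall x y z,
        Order.min (addx (l x y) (l y z)) (addx (l y z) (l x y)) <= l x z].

(* The carrier is pointed because measurable types are; this is no restriction
   since the reference measure is non-zero. *)
Record spacetime (R : realType) := Spacetime {
  carrier :> ptopologicalType ;
  tsep : carrier -> carrier -> \bar R ;
  refm : {measure set (borel carrier) -> \bar R} ;
  carrier_polish : polish R carrier ;
  tsepP : time_separation tsep ;
  causal_refl : forall x, 0 <= tsep x x ;
  causal_anti : forall x y, 0 <= tsep x y -> 0 <= tsep y x -> x = y ;
  causal_trans : forall x y z,
    0 <= tsep x y -> 0 <= tsep y z -> 0 <= tsep x z ;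
  causal_closed : closed [set p : carrier * carrier | 0 <= tsep p.1 p.2] ;
  refm_radon : radon refm ;
  refm_neq0 : refm [set: carrier] != 0 }.

Definition causal_le (R : realType) (M : spacetime R) (x y : M) : Prop :=
  0 <= tsep x y.

(* A curve on [0, 1] is encoded as a function on R that is constant on
   ]-oo, 0] and on [1, +oo[, so that equal records are equal curves. *)
Record lcc (R : realType) (M : spacetime R) := Lcc {
  curve :> R -> M ;
  curve_causal : forall s t : R, (0 <= s)%R -> (s <= t)%R -> (t <= 1)%R ->
    causal_le (curve s) (curve t) ;
  curve_leftcont : forall t : R, (0 < t)%R -> (t <= 1)%R ->
    curve s @[s --> t^'-] --> curve t ;
  curve_le0 : forall t : R, (t <= 0)%R -> curve t = curve 0%R ;
  curve_ge1 : forall t : R, (1 <= t)%R -> curve t = curve 1%R }.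

Section lcc_pointed.
Context {R : realType} (M : spacetime R).

HB.instance Definition _ := gen_eqMixin (lcc M).
HB.instance Definition _ := gen_choiceMixin (lcc M).

Definition lcc_cst : lcc M :=
  @Lcc R M (fun=> point)
    (fun s t _ _ _ => causal_refl point)
    (fun t _ _ => @cvg_cst M point _ _ _)
    (fun t _ => erefl) (fun t _ => erefl).

HB.instance Definition _ := isPointed.Build (lcc M) lcc_cst.

End lcc_pointed.

Section causal_speed.
Context {R : realType} (M : spacetime R).
Local Notation measureR := {measure set (measurableTypeR R) -> \bar R}.
Local Notation leb := (@lebesgue_measure R).

(* Borel measures on [0, 1] are encoded as measures on R that vanish outside
   [0, 1]. *)
Definition speed_bound (c : lcc M) (nu : measureR) : Prop :=
  nu (~` `[0%R, 1%R]%classic) = 0 /\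
  forall a b : R, (0 <= a)%R -> (a < b)%R -> (b <= 1)%R ->
    nu `]a, b[%classic <= tsep (c a) (c b).

Definition measure_le (mu nu : measureR) : Prop :=
  forall A, measurable A -> mu A <= nu A.

Definition largest_measure (P : measureR -> Prop) (nu : measureR) : Prop :=
  P nu /\ forall mu : measureR, P mu -> measure_le mu nu.

(* For sigma-finite nu this is the absolutely continuous term of the Lebesgue
   decomposition.  The measure defining the causal speed need not be
   sigma-finite, because tsep may take the value +oo: where it restricts to
   +oo times the counting measure there is no Lebesgue decomposition, while the
   largest absolutely continuous measure below it still exists and has density
   +oo. *)
Definition ac_part (nu nuac : measureR) : Prop :=
  largest_measure (fun mu : measureR => mu `<< leb /\ measure_le mu nu) nuac.

Definition is_density (nu : measureR) (v : R -> \bar R) : Prop :=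
  [/\ measurable_fun [set: measurableTypeR R] v,
      forall t, 0 <= v t &
      forall A, measurable A -> nu A = \int[leb]_(t in A) v t].

Definition is_causal_speed (c : lcc M) (v : R -> \bar R) : Prop :=
  exists nu nuac : measureR,
    [/\ largest_measure (speed_bound c) nu, ac_part nu nuac &
        is_density nuac v].

(* A representative of the causal speed, which is determined up to equality
   almost everywhere. *)
Definition causal_speed (c : lcc M) : R -> \bar R :=
  xget (fun=> 0) [set v | is_causal_speed c v].

End causal_speed.

Section slopes.
Context {R : realType} (M : spacetime R) (d : M -> M -> R).
Local Notation leb := (@lebesgue_measure R).
Local Notation m := (@refm R M).

Definition lcc_dist (c e : lcc M) : R :=
  (d (c 0) (e 0) + \int[leb]_(t in `[0, 1]) d (c t) (e t))%R.

Definition lcc_borel := g_sigma_algebraType (dist_open lcc_dist).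

(* m-measurable: measurable for the completion of the Borel sigma-algebra. *)
Definition causal_function (f : M -> \bar R) : Prop :=
  (forall B : set \bar R, measurable B -> completed_algebra_gen m (f @^-1` B))
  /\ forall x y : M, causal_le x y -> f x <= f y.

Definition test_plan (P : probability lcc_borel R) : Prop :=
  exists2 C : R, (0 < C)%R &
    forall t : R, (0 <= t)%R -> (t <= 1)%R ->
    forall A : set (borel M), measurable A ->
      P [set c : lcc M | A (c t)] <= C%:E * m A.

(* The iterated integral of G(c_t) |c'_t| dt dP(c).  The inner integral does not
   depend on the representative of the causal speed.  It is a Borel function of
   c when tsep is Borel; this is not assumed, hence the upper integral. *)
Definition plan_integral (P : probability lcc_borel R) (G : M -> \bar R) :
    \bar R :=
  upper_integral P (fun c : lcc M =>
    \int[leb]_(t in `[0%R, 1%R]) (G (c t) * causal_speed c t)).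

(* The integrand on the left-hand side is nonnegative and measurable for the
   completion of P, and the integral of the library, a supremum over simple
   functions below the integrand, is its integral for the completed measure. *)
Definition weak_subslope (f G : M -> \bar R) : Prop :=
  [/\ measurable_fun [set: borel M] G, forall x, 0 <= G x &
      forall P : probability lcc_borel R, test_plan P ->
        plan_integral P G <= \int[P]_c subx (f (c 1%R)) (f (c 0%R))].

(* G is a version of |df|. *)
Definition is_slope (f G : M -> \bar R) : Prop :=
  weak_subslope f G /\
  forall G', weak_subslope f G' -> {ae m, forall x, G' x <= G x}.

Definition is_plan_density (P : probability lcc_borel R) (rho : M -> \bar R) :
    Prop :=
  [/\ measurable_fun [set: borel M] rho, forall x, 0 <= rho x &
      forall A : set (borel M), measurable A ->
        plan_integral P (fun x => (\1_A x)%:E) = \int[m]_(x in A) rho x].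

Definition contains_visible (V : set (borel M)) : Prop :=
  measurable V /\
  forall (P : probability lcc_borel R) (rho : M -> \bar R),
    test_plan P -> is_plan_density P rho ->
    m.-negligible ([set x | 0 < rho x] `\` V).

(* V is a version of Vis(M). *)
Definition is_Vis (V : set (borel M)) : Prop :=
  contains_visible V /\
  forall W, contains_visible W -> m.-negligible (V `\` W).

End slopes.

Definition lin_comb (R : realType) (T : Type) (a b : R) (f g : T -> \bar R) :
    T -> \bar R :=
  fun x => addx (a%:E * f x) (b%:E * g x).

Definition positively_homogeneous2 (R : realType) (h : R -> R -> \bar R) :
    Prop :=
  forall k a b : R, (0 <= k)%R -> (0 <= a)%R -> (0 <= b)%R ->
    h (k * a)%R (k * b)%R = k%:E * h a b.

Definition concave2 (R : realType) (h : R -> R -> \bar R) : Prop :=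
  forall s a b a' b' : R, (0 <= s)%R -> (s <= 1)%R ->
    (0 <= a)%R -> (0 <= b)%R -> (0 <= a')%R -> (0 <= b')%R ->
    s%:E * h a b + (1 - s)%:E * h a' b' <=
      h (s * a + (1 - s) * a')%R (s * b + (1 - s) * b')%R.

(* Main.v *)
(* For causal x <= y write D_u(x, y) = u(y) - u(x).  With the conventions of
   extended arithmetic D_{a f + b g} = a D_f + b D_g holds exactly.  Since the
   left-hand side of the subslope inequality is an upper integral, hence
   subadditive, and the right-hand side a lower one, hence superadditive, k1 G1 +
   k2 G2 is a weak subslope of u as soon as G1, G2 are weak subslopes of u1, u2
   and k1 D_{u1} + k2 D_{u2} <= D_u; no measurability of u is involved.  This
   gives superadditivity, homogeneity and monotonicity of (a, b) |-> |d(a f + b g)|.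

   On Vis(M): a weak subslope G of a constant has zero plan integral, so every
   plan density vanishes a.e. on {G > 0}, and {G = 0} contains Vis(M).

   For (ii), h_x is the conic hull of countably many slopes at x, those of points
   q_v chosen in each rational box.  Almost everywhere, weights may be taken
   rational, so countably many subslope inequalities give h_x(a, b) <=
   |d(a f + b g)|; conversely there are q_v with k (a, b) <= q_v <= (a, b) / k
   for k < 1 arbitrarily close to 1, whence |d(a f + b g)| <= h_x(a, b) / k^2. *)
Require Import Defs.
From mathcomp Require Import all_boot all_order all_algebra.
From mathcomp Require Import all_classical all_reals all_analysis.
From mathcomp Require Import measurable_realfun.
From mathcomp Require Import ring lra.
Import Order.TTheory GRing.Theory Num.Theory.
Import numFieldNormedType.Exports.
Import HBNNSimple.

Set Implicit Arguments.
Unset Strict Implicit.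
Unset Printing Implicit Defensive.

Local Open Scope classical_set_scope.
Local Open Scope ring_scope.
Local Open Scope ereal_scope.

(** * Suprema, infima and integrals of nonnegative functions that may fail to be measurable *)

(** If [x] is finite, nonnegativity makes every member and [ereal_sup A] finite, so one supremum is
    taken at a time, the other term being moved across by subtraction. *)
Lemma ge0_adde_ereal_sup_le (R : realType) (A B : set (\bar R)) (x : \bar R) :
  A !=set0 -> B !=set0 -> (forall a, A a -> 0 <= a) ->
  (forall b, B b -> 0 <= b) -> (forall a b, A a -> B b -> a + b <= x) ->
  ereal_sup A + ereal_sup B <= x.
Proof.
move=> [a0 Aa0] [b0 Bb0] A0 B0 ABx.
have [->|xoo] := eqVneq x +oo; first by rewrite leey.
have x0 : 0 <= x by rewrite (le_trans _ (ABx _ _ Aa0 Bb0))//; exact: adde_ge0 (A0 _ Aa0) (B0 _ Bb0).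
have xfin : x \is a fin_num by rewrite ge0_fin_numE// ltey.
have finP y : 0 <= y -> y <= x -> y \is a fin_num.
  by move=> y0 yx; rewrite ge0_fin_numE// (le_lt_trans yx)// ltey.
have Ax a : A a -> a <= x.
  by move=> Aa; rewrite (le_trans _ (ABx _ _ Aa Bb0))// leeDl// B0.
have Bx b : B b -> b <= x.
  by move=> Bb; rewrite (le_trans _ (ABx _ _ Aa0 Bb))// leeDr// A0.
have supAfin : ereal_sup A \is a fin_num.
  apply: finP; first by rewrite (le_trans (A0 _ Aa0))// ereal_sup_ubound.
  exact: ge_ereal_sup.
have bsupA b : B b -> b <= x - ereal_sup A.
  move=> Bb; have bfin := finP _ (B0 _ Bb) (Bx _ Bb).
  rewrite leeBrDr// addeC -leeBrDr//.
  by apply: ge_ereal_sup => a Aa; rewrite leeBrDr// ABx.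
by rewrite addeC -leeBrDr//; exact: ge_ereal_sup.
Qed.

(** Nonnegativity excludes -oo, so an infinite infimum makes the right-hand side +oo; two finite
    infima are approached up to [e / 2] each. *)
Lemma ge0_le_adde_ereal_inf (R : realType) (A B : set (\bar R)) (x : \bar R) :
  (forall a, A a -> 0 <= a) -> (forall b, B b -> 0 <= b) ->
  (forall a b, A a -> B b -> x <= a + b) ->
  x <= ereal_inf A + ereal_inf B.
Proof.
move=> A0 B0 xAB.
have infA0 : 0 <= ereal_inf A by exact: le_ereal_inf_tmp.
have infB0 : 0 <= ereal_inf B by exact: le_ereal_inf_tmp.
have [->|infAoo] := eqVneq (ereal_inf A) +oo.
  by rewrite addye ?leey// gt_eqF// (lt_le_trans _ infB0).
have [->|infBoo] := eqVneq (ereal_inf B) +oo.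
  by rewrite addey ?leey// gt_eqF// (lt_le_trans _ infA0).
have Afin : ereal_inf A \is a fin_num by rewrite ge0_fin_numE// ltey.
have Bfin : ereal_inf B \is a fin_num by rewrite ge0_fin_numE// ltey.
apply/lee_addgt0Pr => e e0.
have e20 : (0 < e / 2)%R by rewrite divr_gt0.
have [a Aa alt] := lb_ereal_inf_adherent e20 Afin.
have [b Bb blt] := lb_ereal_inf_adherent e20 Bfin.
rewrite (le_trans (xAB _ _ Aa Bb))// [e]splitr EFinD addeACA.
by rewrite leeD// ltW.
Qed.

(* The integrands need not be measurable: the integral is a supremum over the
   simple functions below the integrand. *)
Lemma ge0_comb_integral_le d (T : measurableType d) (R : realType)
    (mu : {measure set T -> \bar R}) (k1 k2 : R) (f1 f2 f : T -> \bar R) :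
  (0 <= k1)%R -> (0 <= k2)%R ->
  (forall x, 0 <= f1 x) -> (forall x, 0 <= f2 x) ->
  (forall x, k1%:E * f1 x + k2%:E * f2 x <= f x) ->
  k1%:E * \int[mu]_x f1 x + k2%:E * \int[mu]_x f2 x <= \int[mu]_x f x.
Proof.
move=> k10 k20 f10 f20 f12.
have f0 x : 0 <= f x.
  by rewrite (le_trans _ (f12 x))// adde_ge0// mule_ge0// lee_fin.
rewrite !ge0_integralTE//.
have nz g : (forall x, 0 <= g x) -> [set sintegral mu h | h in
    [set h : {nnsfun T >-> R} | forall x, (h x)%:E <= g x]] !=set0.
  by move=> g0; exists (sintegral mu (@nnsfun0 _ T R)); exists nnsfun0.
rewrite -!ereal_supZl//; try exact/set0P/nz.
apply: ge0_adde_ereal_sup_le.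
- by have [y ?] := nz _ f10; exists (k1%:E * y); exists y.
- by have [y ?] := nz _ f20; exists (k2%:E * y); exists y.
- by move=> _ [_ [h _ <-] <-]; rewrite mule_ge0 ?lee_fin// sintegral_ge0.
- by move=> _ [_ [h _ <-] <-]; rewrite mule_ge0 ?lee_fin// sintegral_ge0.
move=> _ _ [_ [h1 h1f <-] <-] [_ [h2 h2f <-] <-].
pose g1 := scale_nnsfun h1 k10; pose g2 := scale_nnsfun h2 k20.
have -> : k1%:E * sintegral mu h1 + k2%:E * sintegral mu h2 =
    sintegral mu (add_nnsfun g1 g2).
  by rewrite -!sintegralrM; rewrite (sintegralD mu g1 g2).
apply: ereal_sup_ubound; exists (add_nnsfun g1 g2) => // x.
rewrite (le_trans _ (f12 x))//= EFinD !EFinM.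
by apply: leeD; apply: lee_wpmul2l; rewrite ?lee_fin.
Qed.

(** Majorants of [f1] and [f2] combine into a majorant of [f], and integrals of majorants add
    because these are measurable. *)
Lemma upper_integral_le_comb d (T : measurableType d) (R : realType)
    (mu : {measure set T -> \bar R}) (k1 k2 : R) (f1 f2 f : T -> \bar R) :
  (0 <= k1)%R -> (0 <= k2)%R ->
  (forall x, f x <= k1%:E * f1 x + k2%:E * f2 x) ->
  upper_integral mu f <=
    k1%:E * upper_integral mu f1 + k2%:E * upper_integral mu f2.
Proof.
move=> k10 k20 f12.
pose S g := [set \int[mu]_x u x | u in [set u : T -> \bar R |
      measurable_fun [set: T] u /\ (forall x, 0 <= u x /\ g x <= u x)]].
have Z g k : (0 <= k)%R ->
    k%:E * upper_integral mu g = ereal_inf [set k%:E * y | y in S g].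
  rewrite le_eqVlt => /predU1P[<-|k0]; last by rewrite ereal_inf_pZl.
  rewrite mul0e; apply/esym.
  (* [S g] is never empty, as it contains the integral of the majorant [cst +oo]; since 0 * +oo = 0,
     the scaled set is exactly {0}. *)
  have -> : [set 0%:E * y | y in S g] = [set 0].
    apply/seteqP; split => [_ [y _ <-]/=|_ ->]; first by rewrite mul0e.
    exists (\int[mu]_x cst +oo x); rewrite ?mul0e//; exists (cst +oo) => //.
    by split => [|x]; [exact: measurable_cst|rewrite /= !leey].
  by rewrite ereal_inf1.
rewrite (Z _ _ k10) (Z _ _ k20); apply: ge0_le_adde_ereal_inf.
- move=> _ [_ [u [_ u0] <-] <-]; rewrite mule_ge0 ?lee_fin// integral_ge0// => x _.
  by have [] := u0 x.
- move=> _ [_ [u [_ u0] <-] <-]; rewrite mule_ge0 ?lee_fin// integral_ge0// => x _.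
  by have [] := u0 x.
move=> _ _ [_ [u [mu_ u0] <-] <-] [_ [v [mv v0] <-] <-].
have u00 x : 0 <= u x by have [] := u0 x.
have v00 x : 0 <= v x by have [] := v0 x.
rewrite -!ge0_integralZl ?lee_fin// -ge0_integralD//; first last.
- exact: measurable_funeM.
- by move=> x _; rewrite mule_ge0 ?lee_fin.
- exact: measurable_funeM.
- by move=> x _; rewrite mule_ge0 ?lee_fin.
apply: ereal_inf_lbound; eexists; last reflexivity.
split; first by apply: emeasurable_funD; exact: measurable_funeM.
move=> x; split; first by rewrite adde_ge0// mule_ge0 ?lee_fin.
rewrite (le_trans (f12 x))//; apply: leeD; apply: lee_wpmul2l;
  rewrite ?lee_fin//.
  by have [] := u0 x.
by have [] := v0 x.
Qed.

(** * Increments in the left-dominant arithmetic *)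

Section extended_increments.
Context {R : realType}.
Implicit Types x y z w : \bar R.

Lemma subx_ge0 x y : x <= y -> 0 <= subx y x.
Proof.
case: x y => [r| |] [s| |] //= rs; rewrite ?leey//.
by rewrite -EFinB lee_fin subr_ge0.
Qed.

Lemma mulr_subx (a : R) x y : (0 < a)%R ->
  subx (a%:E * y) (a%:E * x) = a%:E * subx y x.
Proof.
move=> a0; case: x y => [r| |] [s| |] //=;
  rewrite ?gt0_muley ?gt0_muleNy ?lte_fin//=.
by rewrite -!EFinD -EFinM mulrBr.
Qed.

(* If a weighted increment is infinite then both sides are +oo; otherwise all
   the values carrying a positive weight are finite. *)
Lemma subx_addx (a b : R) x y z w : (0 <= a)%R -> (0 <= b)%R ->
  x <= y -> z <= w ->
  subx (addx (a%:E * y) (b%:E * w)) (addx (a%:E * x) (b%:E * z)) =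
  a%:E * subx y x + b%:E * subx w z.
Proof.
rewrite !le_eqVlt => /predU1P[<-|a0] /predU1P[<-|b0].
- by rewrite !mul0e /= !adde0 /= addr0 oppr0 adde0.
- by rewrite !mul0e /= !add0e mulr_subx.
- have add0 u : addx (a%:E * u) 0 = a%:E * u.
    by case: (_ * _) => //= r; rewrite adde0.
  by rewrite !mul0e !add0 adde0 mulr_subx.
rewrite -!le_eqVlt; move: x y z w => [x| |] [y| |] [z| |] [w| |] //= _ _;
  rewrite ?gt0_muley ?gt0_muleNy ?lte_fin//=.
by rewrite -!EFinD; congr EFin; ring.
Qed.

End extended_increments.

(** * Measurability along curves *)

(** By left continuity, each point of the preimage of an open set is the right end of a half-open
    interval inside it. Rational left bounds then write the preimage as a countable union of
    intervals. *)
Lemma curve_measurable (R : realType) (M : spacetime R) (c : lcc M) :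
  measurable_fun [set: measurableTypeR R] (c : measurableTypeR R -> borel M).
Proof.
have cl (t : R) (U : set M) : open U -> U (c t) ->
    exists2 e : R, (0 < e)%R & forall s, (t - e < s)%R -> (s <= t)%R -> U (c s).
  move=> oU Ut.
  have [t0|t0] := leP t 0%R.
    exists 1%R => // s _ st.
    by rewrite curve_le0 ?(le_trans st)// -(curve_le0 c t0).
  have [t1|t1] := leP t 1%R.
    have := @curve_leftcont _ _ c _ t0 t1 U (open_nbhs_nbhs (conj oU Ut)).
    move=> -[e /= e0 H]; exists e => // s ts.
    rewrite le_eqVlt => /predU1P[->//|st]; apply: H => //=.
    by rewrite ger0_norm ?subr_ge0 ?(ltW st)// ltrBlDl -ltrBlDr.
  exists (t - 1)%R; rewrite ?subr_gt0// => s.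
  rewrite subKr => s1 _.
  by rewrite (curve_ge1 c (ltW s1)) -(curve_ge1 c (ltW t1)).
apply: (@measurability _ _ (measurableTypeR R) (borel M) setT _ (@open M)) => // _ [U oU <-].
rewrite setTI.
pose I (q : rat) := [set t : R | (ratr q < t)%R /\
  forall s, (ratr q < s)%R -> (s <= t)%R -> U (c s)].
have -> : c @^-1` U = \bigcup_q I q.
  apply/seteqP; split => [t Ut|t [q _ [qt]]]; last by apply.
  have [e e0 H] := cl t U oU Ut.
  have /rat_in_itvoo[q] : (t - e < t)%R by rewrite ltrBlDr ltrDl.
  rewrite in_itv/= => /andP[tq qt]; exists q => //; split => // s qs st.
  by apply: H => //; exact: lt_trans qs.
apply: bigcupT_measurable_rat => q; apply: is_interval_measurable.
move=> x y [qx _] [_ Hy] z /andP[xz zy]; split; first exact: lt_le_trans xz.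
by move=> s qs sz; apply: Hy => //; exact: le_trans zy.
Qed.

(** When no causal speed exists [xget] returns the zero function, which is measurable as well. *)
Lemma causal_speed_measurable (R : realType) (M : spacetime R) (c : lcc M) :
  measurable_fun [set: measurableTypeR R] (causal_speed c).
Proof.
rewrite /causal_speed; case: xgetP => [v _ [nu [nuac [_ _ []]]]//|_].
exact: measurable_cst.
Qed.

Lemma causal_speed_ge0 (R : realType) (M : spacetime R) (c : lcc M) t :
  0 <= causal_speed c t.
Proof.
by rewrite /causal_speed; case: xgetP => [v _ [nu [nuac [_ _ []]]]//|_].
Qed.

#[local] Instance ae_refm_filter (R : realType) (M : spacetime R) :
  Filter (nbhs (almost_everywhere (@refm R M))).
Proof. by apply: ae_filter_ringOfSetsType. Qed.

(** * Weak subslopes: combination, scaling, and constants on the visible set *)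

Section weak_subslopes.
Context {R : realType} (M : spacetime R) (d : M -> M -> R).
Local Notation leb := (@lebesgue_measure R).
Implicit Types (G : M -> \bar R) (f : M -> \bar R).

Definition causal_monotone f : Prop :=
  forall x y : M, causal_le x y -> f x <= f y.

Lemma curve_speed_measurable (c : lcc M) G :
  measurable_fun [set: borel M] G ->
  measurable_fun (`[0%R, 1%R]%classic : set (measurableTypeR R))
    (fun t => G (c t) * causal_speed c t).
Proof.
move=> mG; apply: measurable_funTS; apply: emeasurable_funM.
  exact: (measurableT_comp mG (curve_measurable c)).
exact: causal_speed_measurable.
Qed.

(** Along a fixed curve the integrand is measurable, so the inner integral is truly additive; only
    the outer one is an upper integral, which is subadditive. The case [k2 = 0] serves as
    monotonicity up to a factor. *)
Lemma plan_integral_le_comb (P : probability (lcc_borel d) R) (k1 k2 : R)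
    (G1 G2 G : M -> \bar R) : (0 <= k1)%R -> (0 <= k2)%R ->
  measurable_fun [set: borel M] G1 -> measurable_fun [set: borel M] G2 ->
  measurable_fun [set: borel M] G ->
  (forall x, 0 <= G1 x) -> (forall x, 0 <= G2 x) -> (forall x, 0 <= G x) ->
  (forall x, G x <= k1%:E * G1 x + k2%:E * G2 x) ->
  plan_integral P G <= k1%:E * plan_integral P G1 + k2%:E * plan_integral P G2.
Proof.
move=> k10 k20 mG1 mG2 mG G10 G20 G0 GG; apply: upper_integral_le_comb => // c.
have v0 := causal_speed_ge0 c.
have mv G' := @curve_speed_measurable c G'.
rewrite -!ge0_integralZl ?lee_fin//; first last.
- by move=> x _; exact: mule_ge0.
- by apply: mv.
- by move=> x _; exact: mule_ge0.
- by apply: mv.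
rewrite -ge0_integralD//; first last.
- by apply: measurable_funeM; apply: mv.
- by move=> x _; rewrite !mule_ge0 ?lee_fin.
- by apply: measurable_funeM; apply: mv.
- by move=> x _; rewrite !mule_ge0 ?lee_fin.
apply: ge0_le_integral => //.
- by move=> x _; exact: mule_ge0.
- by apply: mv.
- by apply: emeasurable_funD; apply: measurable_funeM; apply: mv.
move=> t _; rewrite !muleA -ge0_muleDl ?mule_ge0 ?lee_fin//.
exact: lee_wpmul2r.
Qed.

(** Increments need comparing only at causally related points: the right-hand side sees a curve
    through its end points alone, and these satisfy [c 0 <= c 1] causally. *)
Lemma weak_subslope_comb (k1 k2 : R) (f1 f2 f G1 G2 : M -> \bar R) :
  (0 <= k1)%R -> (0 <= k2)%R -> causal_monotone f1 -> causal_monotone f2 ->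
  (forall x y, causal_le x y ->
    k1%:E * subx (f1 y) (f1 x) + k2%:E * subx (f2 y) (f2 x) <=
      subx (f y) (f x)) ->
  weak_subslope d f1 G1 -> weak_subslope d f2 G2 ->
  weak_subslope d f (fun x => k1%:E * G1 x + k2%:E * G2 x).
Proof.
move=> k10 k20 f1_mono f2_mono ff [mG1 G10 G1P] [mG2 G20 G2P].
have mG : measurable_fun [set: borel M] (fun x => k1%:E * G1 x + k2%:E * G2 x).
  by apply: emeasurable_funD; exact: measurable_funeM.
have G0 x : 0 <= k1%:E * G1 x + k2%:E * G2 x.
  by rewrite adde_ge0// mule_ge0 ?lee_fin.
split => // P tP.
have c01 (c : lcc M) : causal_le (c 0%R) (c 1%R).
  by apply: curve_causal; rewrite ?lexx ?ler01.
apply: (le_trans (plan_integral_le_comb P k10 k20 mG1 mG2 mG G10 G20 G0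
  (fun=> lexx _))).
apply: (@le_trans _ _ (k1%:E * \int[P]_c subx (f1 (c 1%R)) (f1 (c 0%R)) +
  k2%:E * \int[P]_c subx (f2 (c 1%R)) (f2 (c 0%R)))).
  by apply: leeD; apply: lee_wpmul2l; rewrite ?lee_fin// ?G1P ?G2P.
apply: ge0_comb_integral_le => // c; last exact: ff.
  exact/subx_ge0/f1_mono.
exact/subx_ge0/f2_mono.
Qed.

Lemma weak_subslopeZ (k : R) (f1 f G : M -> \bar R) :
  (0 <= k)%R -> causal_monotone f1 ->
  (forall x y, causal_le x y ->
    k%:E * subx (f1 y) (f1 x) <= subx (f y) (f x)) ->
  weak_subslope d f1 G -> weak_subslope d f (fun x => k%:E * G x).
Proof.
move=> k0 f1_mono ff wG.
have -> : (fun x => k%:E * G x) = (fun x => k%:E * G x + 0%:E * G x).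
  by apply/funext => x; rewrite mul0e adde0.
apply: (weak_subslope_comb k0 (lexx _) f1_mono f1_mono _ wG wG) => x y xy.
by rewrite mul0e adde0 ff.
Qed.

Lemma plan_integral0 (P : probability (lcc_borel d) R) :
  plan_integral P (cst 0) = 0.
Proof.
rewrite /plan_integral.
under eq_fun do under eq_integral do rewrite /= mul0e.
under eq_fun do rewrite integral0.
by rewrite upper_integralE ?integral0.
Qed.

(** Supplies the empty sum of subslopes and the filler for boxes that contain no slope. *)
Lemma weak_subslope0 f : causal_monotone f -> weak_subslope d f (cst 0).
Proof.
move=> f_mono; split => // P _; rewrite plan_integral0; apply: integral_ge0 => c _.
by apply/subx_ge0/f_mono/curve_causal; rewrite ?lexx ?ler01.
Qed.

(** Scaling by [a] turns subslopes of [f] into subslopes of [a f], and scaling by [a^-1] goes back;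
    maximality of each slope gives one inequality. *)
Lemma is_slopeZ (a : R) (f G Ga : M -> \bar R) : (0 < a)%R ->
  causal_monotone f -> is_slope d f G ->
  is_slope d (fun x => a%:E * f x) Ga ->
  {ae @refm R M, forall x, Ga x = a%:E * G x}.
Proof.
move=> a0 f_mono [fG Gmax] [afGa Gamax].
have af_mono : causal_monotone (fun x => a%:E * f x).
  by move=> x y xy; rewrite lee_pmul2l// f_mono.
have le1 : weak_subslope d (fun x => a%:E * f x) (fun x => a%:E * G x).
  by apply: weak_subslopeZ fG; rewrite ?ltW// => x y xy; rewrite mulr_subx.
have le2 : weak_subslope d f (fun x => a^-1%:E * Ga x).
  apply: weak_subslopeZ afGa; rewrite ?invr_ge0 ?ltW// => x y xy.
  by rewrite mulr_subx// muleA -EFinM mulVf ?gt_eqF// mul1e.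
near=> x.
have GGa : a%:E * G x <= Ga x by near: x; exact: Gamax le1.
have GaG : a^-1%:E * Ga x <= G x by near: x; exact: Gmax le2.
apply/eqP; rewrite eq_le GGa andbT.
by rewrite -lee_pdivrMl// -lee_fin.
Unshelve. all: by end_near. Qed.

Lemma is_slope_cst0_visible (G0 : M -> \bar R) (f : M -> \bar R)
    (V : set (borel M)) :
  is_slope d (fun x => 0%:E * f x) G0 -> is_Vis d V ->
  {ae @refm R M, forall x, V x -> G0 x = 0}.
Proof.
move=> [[mG0 G00 G0P] _] [[mV _] Vmin].
pose W : set (borel M) := [set x | G0 x <= 0].
suff : contains_visible d W.
  move=> /Vmin; rewrite /almost_everywhere /=; apply: negligibleS => x /= H.
  have [Vx G0x] := (not_implyP _ _).1 H; split => // Wx.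
  by apply: G0x; apply/eqP; rewrite eq_le Wx G00.
have mW : measurable W.
  by rewrite -[W]setTI; exact: emeasurable_fun_infty_c.
split => // P rho tP [mrho rho0 rhoP].
have PG0 : plan_integral P G0 <= 0.
  apply: le_trans (G0P P tP) _.
  (* The product with 0 is 0 even where [f] is infinite, so every increment vanishes. *)
  by rewrite integral0_eq// => c _; rewrite !mul0e /= oppr0 adde0.
(* Markov's inequality: the indicator of [A n] is at most [n * G0], whose plan integral is 0, so
   [rho] vanishes almost everywhere on [A n]. These sets exhaust the complement of [W]. *)
pose A n : set (borel M) := [set x | 1 <= n%:R%:E * G0 x].
have mA n : measurable (A n).
  rewrite -[A n]setTI; apply: emeasurable_fun_c_infty => //.
  exact: measurable_funeM.
have rhoA n : {ae @refm R M, forall x, A n x -> rho x = 0}.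
  apply/(ae_eq_integral_abs _ (mA n)); first exact: measurable_funTS.
  under eq_integral do rewrite gee0_abs//.
  apply/eqP; rewrite eq_le integral_ge0// andbT -rhoP//.
  have le1 x : (\1_(A n) x)%:E <= n%:R%:E * G0 x + 0%:E * G0 x.
    rewrite mul0e adde0 indicE; case: (boolP (x \in A n)) => [|_].
      by rewrite inE.
    by rewrite mule_ge0 ?lee_fin.
  apply: le_trans (plan_integral_le_comb P _ _ mG0 mG0 _ G00 G00 _ le1) _ => //.
  - by apply/measurable_EFinP; exact: measurable_indic.
  - by rewrite mul0e adde0 mule_ge0_le0 ?lee_fin.
have := ae_foralln rhoA; apply: negligibleS => x /= [rhox /negP].
rewrite -ltNge => G0x H.
suff [n An] : exists n, A n x by move: rhox; rewrite (H n An) ltxx.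
case E : (G0 x) G0x => [r| |]//; rewrite ?lte_fin => r0.
  exists (Num.bound r^-1); rewrite /A/= E -EFinM lee_fin.
  by rewrite -ler_pdivrMr// mul1r ltW// archi_boundP// invr_ge0 ltW.
by exists 1%N; rewrite /A/= E mul1e leey.
Qed.

End weak_subslopes.

(** * The conic hull of countably many values *)

Section conic_hull.
Context {R : realType} {I : Type}.
Variables (q1 q2 : I -> R) (G : I -> \bar R).
Implicit Types (q : I -> R) (s : seq (R * I)).
Hypothesis G0 : forall i, 0 <= G i.

(** A list of pairs encodes a finite combination of indexed points; indices may repeat, so that
    concatenation adds combinations. *)
Definition nneg_weights s : bool := all (fun w => 0 <= w.1)%R s.

Definition weighted_sum q s : R := (\sum_(w <- s) w.1 * q w.2)%R.

Definition weighted_esum s : \bar R := \sum_(w <- s) w.1%:E * G w.2.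

(** Domination instead of equality lets weights be rounded down to rationals. *)
Definition below a b s : Prop :=
  [/\ nneg_weights s, (weighted_sum q1 s <= a)%R & (weighted_sum q2 s <= b)%R].

(* The least monotone, concave and positively homogeneous function on the
   quadrant that is at least [G i] at each point [(q1 i, q2 i)]. *)
Definition conic_hull a b : \bar R :=
  ereal_sup [set weighted_esum s | s in below a b].

Lemma weighted_esum_ge0 s : nneg_weights s -> 0 <= weighted_esum s.
Proof.
rewrite /weighted_esum; elim: s => [_|w s IH /=]; first by rewrite big_nil.
move=> /andP[w0 s0]; rewrite big_cons adde_ge0// ?mule_ge0 ?lee_fin//.
exact: IH.
Qed.

Lemma below_cat a b a' b' s s' :
  below a b s -> below a' b' s' -> below (a + a')%R (b + b')%R (s ++ s').
Proof.
move=> [s0 s1 s2] [s0' s1' s2']; split.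
- by rewrite /nneg_weights all_cat; apply/andP.
- by rewrite /weighted_sum big_cat lerD.
- by rewrite /weighted_sum big_cat lerD.
Qed.

Definition scale_weights (k : R) s := [seq (k * w.1, w.2)%R | w <- s].

Lemma weighted_sum_scale q k s :
  weighted_sum q (scale_weights k s) = (k * weighted_sum q s)%R.
Proof.
rewrite /weighted_sum big_map mulr_sumr; apply: eq_bigr => w _.
by rewrite mulrA.
Qed.

Lemma weighted_esum_scale k s : nneg_weights s ->
  weighted_esum (scale_weights k s) = k%:E * weighted_esum s.
Proof.
rewrite /weighted_esum; elim: s => [_|w s IH]; first by rewrite !big_nil mule0.
move=> /andP[w0 s0]; rewrite /= !big_cons IH//= ge0_muleDr.
- by rewrite EFinM muleA.
- by rewrite mule_ge0 ?lee_fin.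
- exact: weighted_esum_ge0.
Qed.

Lemma below_scale k a b s : (0 <= k)%R ->
  below a b s -> below (k * a)%R (k * b)%R (scale_weights k s).
Proof.
move=> k0 [s0 s1 s2]; split; rewrite ?weighted_sum_scale ?ler_wpM2l//.
rewrite /nneg_weights /scale_weights all_map.
by apply: sub_all s0 => w /= w0; rewrite mulr_ge0.
Qed.

Lemma below_nil a b : (0 <= a)%R -> (0 <= b)%R -> below a b [::].
Proof. by move=> a0 b0; split => //; rewrite /weighted_sum big_nil. Qed.

Lemma conic_hull_ge0 a b : (0 <= a)%R -> (0 <= b)%R -> 0 <= conic_hull a b.
Proof.
move=> a0 b0; apply: ereal_sup_ubound; exists [::]; first exact: below_nil.
by rewrite /weighted_esum big_nil.
Qed.

Lemma conic_hull_ge k i a b : (0 <= k)%R ->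
  (k * q1 i <= a)%R -> (k * q2 i <= b)%R -> k%:E * G i <= conic_hull a b.
Proof.
move=> k0 ka kb; apply: ereal_sup_ubound; exists [:: (k, i)].
  by split; rewrite /nneg_weights /weighted_sum ?big_seq1//= k0.
by rewrite /weighted_esum big_seq1.
Qed.

(** Concatenating two lists adds both their points and their values. Together with homogeneity this
    superadditivity is concavity. *)
Lemma conic_hullD a b a' b' :
  (0 <= a)%R -> (0 <= b)%R -> (0 <= a')%R -> (0 <= b')%R ->
  conic_hull a b + conic_hull a' b' <= conic_hull (a + a')%R (b + b')%R.
Proof.
move=> a0 b0 a'0 b'0; apply: ge0_adde_ereal_sup_le.
- by exists (weighted_esum [::]); exists [::] => //; exact: below_nil.
- by exists (weighted_esum [::]); exists [::] => //; exact: below_nil.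
- by move=> _ [s [s0 _ _] <-]; exact: weighted_esum_ge0.
- by move=> _ [s [s0 _ _] <-]; exact: weighted_esum_ge0.
move=> _ _ [s sab <-] [s' sab' <-]; apply: ereal_sup_ubound.
exists (s ++ s'); first exact: below_cat.
by rewrite /weighted_esum big_cat.
Qed.

Hypotheses (q10 : forall i, (0 <= q1 i)%R) (q20 : forall i, (0 <= q2 i)%R).
Hypothesis q_neq0 : forall i, (0 < q1 i + q2 i)%R.

(** Each [q1 i + q2 i] is positive, so a nonnegative combination below the origin has only zero
    weights; infinite values of [G] then contribute 0. *)
Lemma conic_hull00 : conic_hull 0%R 0%R = 0.
Proof.
apply/eqP; rewrite eq_le conic_hull_ge0// andbT.
apply: ge_ereal_sup => _ [s [s0 s1 s2] <-].
have : (weighted_sum (q1 \+ q2) s <= 0)%R.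
  rewrite /weighted_sum; under eq_bigr do rewrite /= mulrDr.
  by rewrite big_split; apply: le_trans (lerD s1 s2) _; rewrite addr0.
rewrite /weighted_sum /weighted_esum.
elim: s s0 {s1 s2} => [|w s IH] /=; first by rewrite !big_nil.
move=> /andP[w0 s0]; rewrite !big_cons => ws.
have s_ge0 : (0 <= \sum_(w <- s) w.1 * (q1 w.2 + q2 w.2))%R.
  elim: s s0 {IH ws} => [|v s IH] /=; first by rewrite big_nil.
  by move=> /andP[v0 s0]; rewrite big_cons addr_ge0 ?mulr_ge0 ?addr_ge0 ?IH.
have wq0 : (0 <= w.1 * (q1 w.2 + q2 w.2))%R by rewrite mulr_ge0 ?addr_ge0.
have w10 : w.1 = 0%R.
  have : (w.1 * (q1 w.2 + q2 w.2) <= 0)%R by apply: le_trans ws; rewrite lerDl.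
  by rewrite pmulr_lle0// => w1; apply/eqP; rewrite eq_le w1.
rewrite w10 mul0e add0e; apply: IH => //.
by apply: le_trans ws; rewrite lerDr.
Qed.

Lemma conic_hullZ : positively_homogeneous2 conic_hull.
Proof.
have le (k a b : R) : (0 < k)%R ->
    k%:E * conic_hull a b <= conic_hull (k * a)%R (k * b)%R.
  move=> k0; rewrite -lee_pdivlMl//; apply: ge_ereal_sup => _ [s sab <-].
  rewrite lee_pdivlMl//; apply: ereal_sup_ubound; exists (scale_weights k s).
    exact/below_scale/sab/ltW.
  by rewrite weighted_esum_scale//; case: sab.
move=> k a b; rewrite le_eqVlt => /predU1P[<- _ _|k0 a0 b0].
  by rewrite !mul0r mul0e conic_hull00.
(* The reverse inequality is [le] for the factor [k^-1] at the scaled point. *)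
apply/eqP; rewrite eq_le le// andbT -lee_pdivrMl//.
have := le k^-1%R (k * a)%R (k * b)%R; rewrite invr_gt0 => /(_ k0).
by rewrite !mulrA mulVf ?gt_eqF// !mul1r.
Qed.

Lemma conic_hull_concave : concave2 conic_hull.
Proof.
move=> s a b a' b' s0 s1 a0 b0 a'0 b'0.
have s10 : (0 <= 1 - s)%R by rewrite subr_ge0.
rewrite -!conic_hullZ//.
by apply: conic_hullD; exact: mulr_ge0.
Qed.

(** For countable [I] these lists are countably many, so almost everywhere statements about them can
    be intersected. *)
Definition real_weights (t : seq (rat * I)) : seq (R * I) :=
  [seq (ratr w.1, w.2) | w <- t].

(** Each weight [w] is rounded down to a rational between [r * w] and [w]: the points have
    nonnegative coordinates and only decrease, while the value loses at most the factor [r]. *)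
Lemma rational_weights r s : (0 < r < 1)%R -> nneg_weights s ->
  exists t, [/\ nneg_weights (real_weights t),
    (weighted_sum q1 (real_weights t) <= weighted_sum q1 s)%R,
    (weighted_sum q2 (real_weights t) <= weighted_sum q2 s)%R &
    r%:E * weighted_esum s <= weighted_esum (real_weights t)].
Proof.
move=> /andP[r0 r1]; rewrite /weighted_sum /weighted_esum.
elim: s => [_|w s IH /= /andP[w0 s0]].
  by exists [::]; rewrite /= !big_nil mule0.
have [t [t0 t1 t2 tG]] := IH s0.
have [v [v0 rv vw]] : exists v : rat,
    [/\ (0 <= ratr v :> R)%R, (r * w.1 <= ratr v)%R & (ratr v <= w.1)%R].
  move: w0; rewrite le_eqVlt => /predU1P[<-|w0].
    by exists 0%R; rewrite rmorph0 mulr0.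
  have /rat_in_itvoo[v] : (r * w.1 < w.1)%R by rewrite gtr_pMl.
  rewrite in_itv/= => /andP[rv vw]; exists v; split; rewrite ?ltW//.
  by rewrite (lt_trans _ rv)// mulr_gt0.
exists ((v, w.2) :: t); split; rewrite /= ?big_cons.
- by rewrite v0.
- by rewrite lerD// ler_wpM2r.
- by rewrite lerD// ler_wpM2r.
rewrite ge0_muleDr.
- by rewrite muleA -EFinM leeD// lee_wpmul2r// lee_fin.
- by rewrite mule_ge0 ?lee_fin.
- exact: weighted_esum_ge0.
Qed.

Lemma conic_hull_le a b x :
  (forall t, below a b (real_weights t) ->
    weighted_esum (real_weights t) <= x) ->
  conic_hull a b <= x.
Proof.
move=> H; apply: ge_ereal_sup => _ [s [s0 s1 s2] <-].
(* The factor [r] lost by rounding is removed by letting it tend to 1. *)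
apply/lee_mul01Pr => [|r r01]; first exact: weighted_esum_ge0.
have [t [t0 t1 t2 /le_trans]] := rational_weights r01 s0; apply; apply: H.
by split; [|exact: le_trans s1|exact: le_trans s2].
Qed.

End conic_hull.

(** * Countable intersections and rational approximation *)

Lemma ae_forall_count dT (T : measurableType dT) (R : realType)
    (mu : {measure set T -> \bar R}) (I : countType) (P : I -> T -> Prop) :
  (forall i, {ae mu, forall x, P i x}) -> {ae mu, forall x, forall i, P i x}.
Proof.
move=> H.
have : {ae mu, forall x, forall n, forall i, unpickle n = Some i -> P i x}.
  apply: ae_foralln => n; case: (unpickle n) => [j|]; last first.
    by apply: filterE.
  by have := H j; apply: filterS => x Px i [<-].
by apply: filterS => x Px i; apply: (Px (pickle i)); rewrite pickleK.
Qed.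

(** The bounds are rationals in []k a, a[] and []a, a / k[]. For [a = 0] the interval degenerates to
    {0}, hence the large inequalities. *)
Lemma rational_bracket (R : realType) (k a : R) : (0 < k < 1)%R -> (0 <= a)%R ->
  exists v : rat * rat, [/\ (k * a <= ratr v.1)%R, (ratr v.1 <= a)%R,
    (a <= ratr v.2)%R & (k * ratr v.2 <= a)%R].
Proof.
move=> /andP[k0 k1]; rewrite le_eqVlt => /predU1P[<-|a0].
  by exists (0%R, 0%R); rewrite /= !rmorph0 !mulr0.
have /rat_in_itvoo[v] : (k * a < a)%R by rewrite gtr_pMl.
have /rat_in_itvoo[w] : (a < k^-1 * a)%R by rewrite ltr_pMl// invf_gt1.
rewrite !in_itv/= => /andP[aw wa] /andP[av va].
by exists (v, w); split; rewrite /= ?ltW// mulrC -ltr_pdivlMr// mulrC.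
Qed.

(** * Slopes of linear combinations and their identification with a conic hull *)

Section slopes_of_linear_combinations.
Context {R : realType} (M : spacetime R) (d : M -> M -> R) (f g : M -> \bar R).
Hypotheses (f_mono : causal_monotone f) (g_mono : causal_monotone g).
Local Notation L a b := (lin_comb a b f g).

Lemma lin_comb_monotone a b : (0 <= a)%R -> (0 <= b)%R -> causal_monotone (L a b).
Proof.
move=> a0 b0 x y xy; rewrite /lin_comb.
have : a%:E * f x <= a%:E * f y by rewrite lee_wpmul2l ?lee_fin ?f_mono.
have : b%:E * g x <= b%:E * g y by rewrite lee_wpmul2l ?lee_fin ?g_mono.
case: (a%:E * f x) (a%:E * f y) => [r| |] [s| |]//= gxy rs; rewrite ?leey ?leNye//.
exact: leeD.
Qed.

Lemma lin_comb_increment a b x y : (0 <= a)%R -> (0 <= b)%R -> causal_le x y ->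
  subx (L a b y) (L a b x) =
  a%:E * subx (f y) (f x) + b%:E * subx (g y) (g x).
Proof. by move=> a0 b0 xy; rewrite subx_addx// ?f_mono ?g_mono. Qed.

(** Increments of [f] and [g] are nonnegative, so larger coefficients give larger increments. This
    is monotonicity in the coefficients for [k = 1], and homogeneity when both bounds are
    equalities. *)
Lemma lin_comb_weak_subslopeZ k a b a' b' G :
  (0 <= k)%R -> (0 <= a)%R -> (0 <= b)%R ->
  (k * a <= a')%R -> (k * b <= b')%R ->
  weak_subslope d (L a b) G ->
  weak_subslope d (L a' b') (fun x => k%:E * G x).
Proof.
move=> k0 a0 b0 aa' bb'.
have a'0 : (0 <= a')%R by apply: le_trans aa'; rewrite mulr_ge0.
have b'0 : (0 <= b')%R by apply: le_trans bb'; rewrite mulr_ge0.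
apply: weak_subslopeZ => //; first exact: lin_comb_monotone.
move=> x y xy; have f0 := subx_ge0 (f_mono xy); have g0 := subx_ge0 (g_mono xy).
rewrite !lin_comb_increment// ge0_muleDr ?mule_ge0 ?lee_fin// !muleA -!EFinM.
by apply: leeD; apply: lee_wpmul2r; rewrite ?lee_fin.
Qed.

Lemma lin_comb_weak_subslopeD k a b a' b' G G' :
  (0 <= k)%R -> (0 <= a)%R -> (0 <= b)%R -> (0 <= a')%R -> (0 <= b')%R ->
  weak_subslope d (L a b) G -> weak_subslope d (L a' b') G' ->
  weak_subslope d (L (k * a + a')%R (k * b + b')%R)
    (fun x => k%:E * G x + G' x).
Proof.
move=> k0 a0 b0 a'0 b'0 wG wG'.
have -> : (fun x => k%:E * G x + G' x) = (fun x => k%:E * G x + 1%:E * G' x).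
  by apply/funext => x; rewrite mul1e.
apply: (weak_subslope_comb k0 ler01 _ _ _ wG wG').
- exact: lin_comb_monotone.
- exact: lin_comb_monotone.
move=> x y xy; have f0 := subx_ge0 (f_mono xy); have g0 := subx_ge0 (g_mono xy).
rewrite !lin_comb_increment ?addr_ge0 ?mulr_ge0// mul1e.
rewrite ge0_muleDr ?mule_ge0 ?lee_fin// !muleA -!EFinM addeACA.
by rewrite -!ge0_muleDl ?lee_fin ?mulr_ge0.
Qed.

(** Induction on the list; the signs of the two sums are carried along because adding a further term
    requires nonnegative coefficients. *)
Lemma weighted_weak_subslope (I : Type) (q1 q2 : I -> R) (G : I -> M -> \bar R) s :
  (forall i, (0 <= q1 i)%R) -> (forall i, (0 <= q2 i)%R) ->
  (forall i, weak_subslope d (L (q1 i) (q2 i)) (G i)) ->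
  nneg_weights s ->
  [/\ (0 <= weighted_sum q1 s)%R, (0 <= weighted_sum q2 s)%R &
    weak_subslope d (L (weighted_sum q1 s) (weighted_sum q2 s))
      (fun x => weighted_esum (G ^~ x) s)].
Proof.
move=> q10 q20 wG; rewrite /weighted_sum /weighted_esum.
elim: s => [_|w s IH /= /andP[w0 s0]].
  have -> : (fun x => \sum_(w <- [::]) w.1%:E * G w.2 x) = cst 0.
    by apply/funext => x; rewrite big_nil.
  rewrite !big_nil; split => //.
  exact/weak_subslope0/lin_comb_monotone.
have [s1 s2 sG] := IH s0.
have -> : (fun x => \sum_(v <- w :: s) v.1%:E * G v.2 x) =
    (fun x => w.1%:E * G w.2 x + \sum_(v <- s) v.1%:E * G v.2 x).
  by apply/funext => x; rewrite big_cons.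
rewrite !big_cons; split; try by rewrite addr_ge0 ?mulr_ge0.
exact: lin_comb_weak_subslopeD.
Qed.

Definition box := ((rat * rat) * (rat * rat))%type.

Definition in_box (v : box) (a b : R) : Prop :=
  [/\ (ratr v.1.1 <= a)%R, (a <= ratr v.1.2)%R,
      (ratr v.2.1 <= b)%R & (b <= ratr v.2.2)%R].

Definition slope_in_box v (p : R * R * (M -> \bar R)) : Prop :=
  [/\ in_box v p.1.1 p.1.2, (0 <= p.1.1)%R, (0 <= p.1.2)%R,
      (0 < p.1.1 + p.1.2)%R & is_slope d (L p.1.1 p.1.2) p.2].

(* Not every linear combination is assumed to have a slope: each rational box
   contributes the slope of one of its points, if there is one. *)
Lemma slope_selection : exists (q1 q2 : box -> R) (G : box -> M -> \bar R),
  [/\ forall v, (0 <= q1 v)%R, forall v, (0 <= q2 v)%R,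
      forall v, (0 < q1 v + q2 v)%R,
      forall v, weak_subslope d (L (q1 v) (q2 v)) (G v) &
      forall v p, slope_in_box v p -> slope_in_box v (q1 v, q2 v, G v)].
Proof.
have /choice[s sP] : forall v, exists p : R * R * (M -> \bar R),
    [/\ (0 <= p.1.1)%R, (0 <= p.1.2)%R, (0 < p.1.1 + p.1.2)%R &
      weak_subslope d (L p.1.1 p.1.2) p.2] /\
    forall p', slope_in_box v p' -> slope_in_box v p.
  move=> v; have [[p vp]|no] := pselect (exists p, slope_in_box v p).
    by exists p; split => //; case: vp => _ ? ? ? [].
  (* A box without slopes receives the point (1, 1) with subslope 0, which lies off the origin and
     adds nothing to the hull. *)
  exists (1%R, 1%R, cst 0); split; last by move=> p vp; case: no; exists p.
  split; rewrite /= ?ler01 ?addr_gt0//.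
  exact/weak_subslope0/lin_comb_monotone.
exists (fun v => (s v).1.1), (fun v => (s v).1.2), (fun v => (s v).2).
by split=> v; have [[]] := sP v.
Qed.

Lemma slope_eq_conic_hull (q1 q2 : box -> R) (G : box -> M -> \bar R) a b Gab :
  (forall v, (0 <= q1 v)%R) -> (forall v, (0 <= q2 v)%R) ->
  (forall v, weak_subslope d (L (q1 v) (q2 v)) (G v)) ->
  (forall v p, slope_in_box v p -> slope_in_box v (q1 v, q2 v, G v)) ->
  (0 <= a)%R -> (0 <= b)%R -> (0 < a + b)%R -> is_slope d (L a b) Gab ->
  {ae @refm R M, forall y, Gab y = conic_hull q1 q2 (G ^~ y) a b}.
Proof.
move=> q10 q20 wG boxG a0 b0 ab0 [wGab Gabmax].
have G0 v y : 0 <= G v y by case: (wG v).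
have Gab0 y : 0 <= Gab y by case: wGab.
have hull_le : {ae @refm R M, forall y, forall t,
    below q1 q2 a b (real_weights t) ->
    weighted_esum (G ^~ y) (real_weights t) <= Gab y}.
  apply: ae_forall_count => t.
  have [[t0 t1 t2]|no] := pselect (below q1 q2 a b (real_weights t)); last first.
    exact: filterE.
  have [t10 t20 tG] := weighted_weak_subslope q10 q20 wG t0.
  rewrite -(mul1r (weighted_sum _ _)) in t1.
  rewrite -(mul1r (weighted_sum _ _)) in t2.
  have := Gabmax _ (lin_comb_weak_subslopeZ ler01 t10 t20 t1 t2 tG).
  by apply: filterS => y; rewrite mul1e.
have le_hull : {ae @refm R M, forall y, forall r : rat, (0 < (ratr r : R) < 1)%R ->
    (ratr r)%:E * Gab y <= conic_hull q1 q2 (G ^~ y) a b}.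
  apply: ae_forall_count => r.
  have [/andP[r0 r1]|no] := pselect ((0 < (ratr r : R) < 1)%R); last first.
    exact: filterE.
  (* The factor [k] is lost twice, and this mean satisfies [r <= k * k] with [k < 1]. *)
  pose k : R := ((1 + ratr r) / 2)%R.
  have k0 : (0 < k)%R by rewrite /k; lra.
  have k1 : (k < 1)%R by rewrite /k; lra.
  have rk : (ratr r <= k * k)%R by rewrite /k; nra.
  have k01 : (0 < k < 1)%R by rewrite k0.
  have [va [va1 va2 va3 va4]] := rational_bracket k01 a0.
  have [vb [vb1 vb2 vb3 vb4]] := rational_bracket k01 b0.
  (* The box contains [(a, b)], which has the slope [Gab], so the selected entry is a genuine slope
     there and is maximal. *)
  have [/= [qa1 qa2 qb1 qb2] _ _ _ [_ Gmax]] :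
      slope_in_box (va, vb) (q1 (va, vb), q2 (va, vb), G (va, vb)).
    by apply: (boxG _ (a, b, Gab)).
  set v := (va, vb) in qa1 qa2 qb1 qb2 Gmax.
  have := Gmax _ (lin_comb_weak_subslopeZ (ltW k0) a0 b0 (le_trans va1 qa1)
    (le_trans vb1 qb1) wGab).
  apply: filterS => y kG _.
  (* The chain is [r Gab <= k (k Gab) <= k G v <= conic_hull], the last step because [k] times the
     selected point lies below [(a, b)]. *)
  apply: (@le_trans _ _ (k%:E * G v y)); last first.
    apply: conic_hull_ge; first exact: ltW.
      by apply: le_trans va4; rewrite ler_pM2l.
    by apply: le_trans vb4; rewrite ler_pM2l.
  apply: (@le_trans _ _ (k%:E * (k%:E * Gab y))).
    by rewrite muleA -EFinM lee_wpmul2r ?lee_fin.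
  by rewrite lee_wpmul2l// lee_fin ltW.
move: hull_le le_hull; apply: filterS2 => y hull_le le_hull.
apply/eqP; rewrite eq_le; apply/andP; split; last exact: conic_hull_le.
apply/lee_mul01Pr => // r /andP[r0 r1].
(* The exceptional null set was controlled for rational factors only; a rational between [r] and 1
   suffices. *)
have /rat_in_itvoo[q] := r1; rewrite in_itv/= => /andP[rq q1'].
apply: le_trans (le_hull q _); last by rewrite (lt_trans r0 rq).
by rewrite lee_wpmul2r// lee_fin ltW.
Qed.

End slopes_of_linear_combinations.

Theorem proposition3p21 (R : realType) (M : spacetime R) (d : M -> M -> R)
    (hd : bounded_distance d) (f g : M -> \bar R)
    (hf : causal_function f) (hg : causal_function g) :
  (forall a b : R, (0 <= a)%R -> (0 <= b)%R ->
    forall Gf Gg Gab : M -> \bar R,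
    is_slope d f Gf -> is_slope d g Gg ->
    is_slope d (lin_comb a b f g) Gab ->
    {ae @refm R M, forall x, a%:E * Gf x + b%:E * Gg x <= Gab x}) /\
  (forall Gf G0 : M -> \bar R,
    is_slope d f Gf -> is_slope d (fun x => 0%:E * f x) G0 ->
    forall V : set (borel M), is_Vis d V ->
    {ae @refm R M, forall x, V x -> G0 x = 0%:E * Gf x}) /\
  (forall a : R, (0 < a)%R -> forall Gf Ga : M -> \bar R,
    is_slope d f Gf -> is_slope d (fun x => a%:E * f x) Ga ->
    {ae @refm R M, forall x, Ga x = a%:E * Gf x}) /\
  (exists h : M -> R -> R -> \bar R,
    (forall x : M,
      [/\ forall a b : R, (0 <= a)%R -> (0 <= b)%R -> 0 <= h x a b,
          concave2 (h x) & positively_homogeneous2 (h x)]) /\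
    (forall a b : R, (0 <= a)%R -> (0 <= b)%R -> (a, b) <> (0, 0)%R ->
      forall Gab : M -> \bar R, is_slope d (lin_comb a b f g) Gab ->
      {ae @refm R M, forall y, Gab y = h y a b})).

Proof.
have f_mono : causal_monotone f by case: hf.
have g_mono : causal_monotone g by case: hg.
split.
  move=> a b a0 b0 Gf Gg Gab [wf _] [wg _] [_ Gmax]; apply: Gmax.
  apply: (weak_subslope_comb a0 b0 f_mono g_mono _ wf wg) => x y xy.
  by rewrite (lin_comb_increment f_mono g_mono).
split.
  move=> Gf G0 _ sG0 V visV.
  have := is_slope_cst0_visible sG0 visV.
  by apply: filterS => x H /H ->; rewrite mul0e.
split; first by move=> a a0 Gf Ga; exact: is_slopeZ.
have [q1 [q2 [G [q10 q20 q0 wG boxG]]]] := slope_selection d f_mono g_mono.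
(* Concavity and homogeneity hold at every [x], because the selected subslopes are nonnegative
   everywhere; only the equality with the slopes is up to null sets. *)
exists (fun x => conic_hull q1 q2 (G ^~ x)); split.
  move=> x; have G0 v : 0 <= G v x by case: (wG v).
  split; [exact: conic_hull_ge0|exact: conic_hull_concave|exact: conic_hullZ].
move=> a b a0 b0 ab Gab; apply: slope_eq_conic_hull => //.
rewrite lt_neqAle addr_ge0// andbT eq_sym paddr_eq0//.
by apply/negP => /andP[/eqP a_0 /eqP b_0]; apply: ab; rewrite a_0 b_0.
Qed.
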